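(* Let $m$ be a positive integer and $\lambda$ a nonzero real number. For every $n\ge0$, $$D_{m,\lambda}(n,x)=e^{-\frac{x}{m}}\sum_{k=0}^{\infty}\frac{x^{k}}{m^{k}k!}(mk+1)_{n,\lambda}.$$ In particular, $D_{m,\lambda}(n)=e^{-\frac{1}{m}}\sum_{k=0}^{\infty}\frac{1}{m^{k}k!}(mk+1)_{n,\lambda}$.
   Context: For a nonzero real $\lambda$: $(x)_{0,\lambda}=1$, $(x)_{n,\lambda}=x(x-\lambda)\cdots(x-(n-1)\lambda)$; $(x)_n=(x)_{n,1}$. Degenerate Whitney numbers of the second kind $W_{m,\lambda}(n,k)$: $(mx+1)_{n,\lambda}=\sum_{k=0}^{n}W_{m,\lambda}(n,k)m^{k}(x)_{k}$. Degenerate Dowling polynomials: $D_{m,\lambda}(n,x)=\sum_{k=0}^{n}W_{m,\lambda}(n,k)x^{k}$, and $D_{m,\lambda}(n)=D_{m,\lambda}(n,1)$. *)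

(* Defs.v *)
From HB Require Import structures.
From mathcomp Require Import all_boot all_order all_algebra.
From mathcomp Require Import all_classical all_reals all_analysis.
From mathcomp Require Import ring.
Set Implicit Arguments.
Unset Strict Implicit.
Unset Printing Implicit Defensive.
Import Order.TTheory GRing.Theory Num.Theory.
Import numFieldNormedType.Exports.

Local Open Scope classical_set_scope.
Local Open Scope ring_scope.

Definition dfalling (R : realType) (lam x : R) (n : nat) : R :=
  \prod_(i < n) (x - i%:R * lam).

Definition is_whitney2 (R : realType) (m : nat) (lam : R)
    (W : nat -> nat -> R) : Prop :=
  forall (n : nat) (x : R),
    dfalling lam (m%:R * x + 1) n =
    \sum_(k < n.+1) W n k * m%:R ^+ k * dfalling 1 x k.

(* The array characterized by the expansion above: it exists by is_whitney2_ex,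
   and by is_whitney2_uniq its entries with k <= n do not depend on the choice
   made by xget (for m > 0). Entries with k > n are arbitrary. *)
Definition whitney2 (R : realType) (m : nat) (lam : R) : nat -> nat -> R :=
  xget (fun _ _ => 0) [set W | is_whitney2 m lam W].

Definition dowling_poly (R : realType) (m : nat) (lam : R) (n : nat) (x : R)
  : R := \sum_(k < n.+1) whitney2 m lam n k * x ^+ k.

Definition dowling_number (R : realType) (m : nat) (lam : R) (n : nat) : R :=
  dowling_poly m lam n 1.

Lemma is_whitney2_ex (R : realType) (m : nat) (lam : R) :
  exists W, is_whitney2 m lam W.
Proof.
suff H n : exists w : nat -> R, forall x : R,
    dfalling lam (m%:R * x + 1) n =
    \sum_(k < n.+1) w k * m%:R ^+ k * dfalling 1 x k.
  by have [W HW] := choice H; exists W.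
elim: n => [|n [w Hw]].
  exists (fun=> 1) => x.
  by rewrite big_ord1 /dfalling !big_ord0 expr0 !mulr1.
pose c k : R := m%:R * k%:R + 1 - n%:R * lam.
pose w' k := if (k <= n)%N then w k else 0.
exists (fun k => (if k is j.+1 then w' j else 0) + c k * w' k) => x.
rewrite {1}/dfalling big_ord_recr /= -/(dfalling _ _ _) Hw mulr_suml.
under [RHS]eq_bigr => k _ do rewrite -mulrA mulrDl.
rewrite [RHS]big_split [X in _ = X + _]big_ord_recl.
rewrite [X in _ = _ + X]big_ord_recr /=.
have -> : w' n.+1 = 0 by rewrite /w' ltnn.
rewrite mulr0 !mul0r add0r addr0 -big_split /=.
apply: eq_bigr => -[k /= kn] _.
rewrite /bump /= add1n /w' -ltnS kn /dfalling big_ord_recr /= exprS /c.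
ring.
Qed.

Lemma whitney2P (R : realType) (m : nat) (lam : R) :
  is_whitney2 m lam (whitney2 m lam).
Proof. exact: (xgetPex _ (is_whitney2_ex m lam)). Qed.

Lemma is_whitney2_uniq (R : realType) (m : nat) (lam : R)
    (W W' : nat -> nat -> R) :
  (0 < m)%N -> is_whitney2 m lam W -> is_whitney2 m lam W' ->
  forall n k, (k <= n)%N -> W n k = W' n k.
Proof.
move=> m0 HW HW' n; elim/ltn_ind => k IH kn.
have := HW n k%:R; rewrite (HW' n k%:R) => /esym/eqP.
rewrite -subr_eq0 -sumrB (bigD1 (Ordinal (kn : (k < n.+1)%N))) //=.
rewrite big1 ?addr0; last first.
  move=> [i /= ni]; rewrite -val_eqE /= => ik.
  have [lt_ik|lt_ki|/eqP] := ltngtP i k; last by rewrite (negbTE ik).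
    by rewrite IH ?subrr.
  rewrite /dfalling (bigD1 (Ordinal lt_ki)) //= mulr1 subrr.
  by rewrite mul0r !mulr0 subrr.
rewrite -!mulrBl !mulf_eq0 subr_eq0 expf_eq0 pnatr_eq0 (gtn_eqF m0) andbF orbF.
case/orP => [/eqP//|/prodf_eq0[[i /= ik] _]].
by rewrite mulr1 subr_eq0 eqr_nat (gtn_eqF ik).
Qed.

(* Main.v *)
Require Import Defs.
From mathcomp Require Import all_boot all_order all_algebra.
From mathcomp Require Import all_classical all_reals all_analysis.
From mathcomp Require Import ring.
Import Order.TTheory GRing.Theory Num.Theory.
Import numFieldNormedType.Exports.
Local Open Scope classical_set_scope.
Local Open Scope ring_scope.

(* Expanding (mk+1)_{n,lambda} in the basis of the falling factorials (k)_j
   reduces Dobinski's formula to the moments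
   sum_k (y^k / k!) (k)_j = y^j e^y, here with y = x/m. *)

(** The moments come by induction on [j]: since (k+1)_{j+1} = (k+1) (k)_j, the factor k+1 cancels
    against (k+1)!, and shifting the index turns moment [j.+1] into y times moment [j]
    ([cvg_series_exp_coeff_dfalling]). The expansion has n+1 terms whatever k is, so the limit
    passes through it term by term, and m^j (x/m)^j = x^j leaves the Dowling polynomial times
    e^{x/m}. *)

Lemma dfalling1S (R : realType) (k j : nat) :
  dfalling (1 : R) k.+1%:R j.+1 = k.+1%:R * dfalling 1 k%:R j.
Proof.
rewrite /dfalling big_ord_recl mul0r subr0; congr (_ * _).
by apply: eq_bigr => i _ /=; rewrite /bump /= add1n -!natr1; ring.
Qed.

Lemma cvg_series_exp_coeff_dfalling (R : realType) (y : R) (j : nat) :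
  series (fun k => exp_coeff y k * dfalling 1 k%:R j) @ \oo
    --> y ^+ j * expR y.
Proof.
elim: j => [|j IHj].
  rewrite expr0 mul1r.
  under eq_fun => k do rewrite /dfalling big_ord0 mulr1.
  exact: is_cvg_series_exp_coeff.
(* The term k = 0 vanishes because (0)_{j+1} = 0, so n+1 terms of this series match n terms of the
   previous one; hence the shift. *)
rewrite exprS -mulrA -cvg_shiftS.
suff -> : [sequence series (fun k => exp_coeff y k * dfalling 1 k%:R j.+1) n.+1]_n
    = (fun n => y * series (fun k => exp_coeff y k * dfalling 1 k%:R j) n).
  exact: cvgMr.
apply/funext => n; rewrite /series /= big_nat_recl //.
rewrite {1}/dfalling big_ord_recl !mul0r subrr mul0r mulr0 add0r mulr_sumr.
apply: eq_bigr => k _; rewrite dfalling1S /exp_coeff /= exprS factS natrM.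
have k1 : k.+1%:R != 0 :> R by rewrite pnatr_eq0.
have kf : k`!%:R != 0 :> R by rewrite pnatr_eq0 -lt0n fact_gt0.
by field; rewrite nat1r k1 kf.
Qed.

(** Stated for partial sums, so that the interchange of summations involves finite sums only. *)
Lemma dowling_series (R : realType) (m : nat) (lam x : R) (n : nat) :
  series (fun k => x ^+ k / (m%:R ^+ k * k`!%:R)
                   * dfalling lam (m%:R * k%:R + 1) n)
  = fun N => \sum_(j < n.+1) (whitney2 m lam n j * m%:R ^+ j)
      * series (fun k => exp_coeff (x / m%:R) k * dfalling 1 k%:R j) N.
Proof.
apply/funext => N; rewrite /series /=.
under [RHS]eq_bigr => j _ do rewrite mulr_sumr.
rewrite exchange_big /=; apply: eq_bigr => k _.
rewrite (whitney2P m lam n k%:R) mulr_sumr; apply: eq_bigr => j _.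
rewrite /exp_coeff /= expr_div_n invfM; ring.
Qed.

Lemma cvg_dowling_series (R : realType) (m : nat) (lam x : R) (n : nat) :
  (0 < m)%N ->
  series (fun k => x ^+ k / (m%:R ^+ k * k`!%:R)
                   * dfalling lam (m%:R * k%:R + 1) n) @ \oo
    --> dowling_poly m lam n x * expR (x / m%:R).
Proof.
move=> m_gt0; rewrite dowling_series /dowling_poly mulr_suml.
(* The target is put in the shape of a finite sum of moment limits; restoring it cancels
   [m%:R ^+ j], which is nonzero by [m_gt0]. *)
rewrite (_ : \sum_(_ < _) _ = \sum_(j < n.+1)
    (whitney2 m lam n j * m%:R ^+ j) * ((x / m%:R) ^+ j * expR (x / m%:R))).
  apply: cvg_big => [|j _]; first exact: add_continuous.
  apply: cvgMr.
  exact: cvg_series_exp_coeff_dfalling.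
apply: eq_bigr => j _; rewrite expr_div_n.
have mj_neq0 : m%:R ^+ j != 0 :> R by rewrite expf_neq0 // pnatr_eq0 -lt0n.
by field.
Qed.

Theorem theorem10 (R : realType) (m : nat) (lam : R)
    (m_gt0 : (0 < m)%N) (lam_neq0 : lam != 0) (n : nat) :
  (forall x : R,
     let u := fun k : nat =>
       x ^+ k / (m%:R ^+ k * k`!%:R) * dfalling lam (m%:R * k%:R + 1) n in
     cvgn (series u) /\
     dowling_poly m lam n x = expR (- (x / m%:R)) * limn (series u))
  /\
  (let u := fun k : nat =>
     1 / (m%:R ^+ k * k`!%:R) * dfalling lam (m%:R * k%:R + 1) n in
   cvgn (series u) /\
   dowling_number m lam n = expR (- (1 / m%:R)) * limn (series u)).
Proof.
have dobinski x : let u := fun k : nat =>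
       x ^+ k / (m%:R ^+ k * k`!%:R) * dfalling lam (m%:R * k%:R + 1) n in
     cvgn (series u) /\
     dowling_poly m lam n x = expR (- (x / m%:R)) * limn (series u).
  move=> u; have cu := cvg_dowling_series R m lam x n m_gt0.
  split; first by apply/cvg_ex; eexists; exact: cu.
  by rewrite (cvg_lim _ cu) // mulrCA -expRD addNr expR0 mulr1.
split=> // u; have := dobinski 1; rewrite /dowling_number.
by under eq_fun => k do rewrite expr1n.
Qed.
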